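(* Let $A$ be a finite-dimensional unital algebra over $\mathbb C$ with a coproduct $\Delta$ that admits a counit. Assume that $\varphi$ is a faithful left integral on $A$ with antipode $S$ and that $S(1)=1$. Let $\varphi'$ be any left invariant functional on $A$. Then $\varphi'$ is a scalar multiple of $\varphi$.
   Context: A coproduct on $A$ is a linear map $\Delta:A\to A\otimes A$ with $(\Delta\otimes\iota)\Delta=(\iota\otimes\Delta)\Delta$ (not assumed multiplicative or unital); $\iota$ is the identity map. A counit is a linear map $\varepsilon:A\to\mathbb C$ with $(\varepsilon\otimes\iota)\Delta(a)=a=(\iota\otimes\varepsilon)\Delta(a)$ for all $a$. A linear functional $\omega$ on $A$ is faithful if $\omega(ac)=0$ for all $c$ implies $a=0$, and $\omega(ac)=0$ for all $a$ implies $c=0$. A linear functional $\varphi$ on $A$ is a left integral if there is a linear map $S:A\to A$ with $S((\iota\otimes\varphi)(\Delta(a)(1\otimes c)))=(\iota\otimes\varphi)((1\otimes a)\Delta(c))$ for all $a,c\in A$. If $\varphi$ is faithful, $S$ is unique and bijective, and is called the antipode of $\varphi$. A linear functional $\varphi'$ on $A$ is left invariant if $(\iota\otimes\varphi')\Delta(a)=\varphi'(a)1$ for all $a\in A$. *)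

(* Defs.v *)
From HB Require Import structures.
From mathcomp Require Import all_boot all_order all_algebra all_field.
From mathcomp Require Import complex reals.

Set Implicit Arguments.
Unset Strict Implicit.
Unset Printing Implicit Defensive.

Import GRing.Theory VectorInternalTheory.
Local Open Scope ring_scope.

(* The tensor product V ⊗ W of finite-dimensional spaces: a tensor is stored as
   its matrix of coordinates on the products of the library's coordinate bases
   of V and W.  Lemmas [tliftE] and [tlift_uniq] are its universal property;
   the definitions below use the model only through [tens] and [tlift].  The
   alias hides the (unrelated) matrix product on square matrices. *)
Definition tensor (K : fieldType) (V W : vectType K) : Type :=
  'M[K]_(dim V, dim W).

HB.instance Definition _ (K : fieldType) (V W : vectType K) :=
  Vector.on (tensor V W).

Section Tensor.
Variable K : fieldType.
Implicit Types U V W : vectType K.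

Definition tens V W (v : V) (w : W) : tensor V W := (v2r v)^T *m v2r w.

Definition tbase V (i : 'I_(dim V)) : V := r2v (delta_mx 0 i).

(* The linear map V ⊗ W -> U induced by b; only meaningful for bilinear b. *)
Definition tlift V W U (b : V -> W -> U) (t : tensor V W) : U :=
  \sum_(i < dim V) \sum_(j < dim W)
     (t : 'M[K]_(dim V, dim W)) i j *: b (tbase i) (tbase j).

Lemma tbaseE V (v : V) : v = \sum_(i < dim V) v2r v 0 i *: tbase i.
Proof.
rewrite -[LHS]v2rK {1}[v2r v]row_sum_delta linear_sum /=.
by apply: eq_bigr => i _; rewrite linearZ.
Qed.

Lemma tlift_is_linear V W U (b : V -> W -> U) : linear (tlift b).
Proof.
move=> c s t; rewrite /tlift scaler_sumr -big_split; apply: eq_bigr => i _ /=.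
rewrite scaler_sumr -big_split; apply: eq_bigr => j _ /=.
by rewrite !mxE scalerDl scalerA.
Qed.

HB.instance Definition _ V W U (b : V -> W -> U) :=
  GRing.isLinear.Build K (tensor V W) U *:%R (tlift b) (tlift_is_linear b).

Lemma tens_linearl V W (w : W) : linear (fun v : V => tens v w).
Proof. by move=> c u v; rewrite /tens !linearP /= mulmxDl scalemxAl. Qed.

Lemma tens_linearr V W (v : V) : linear (fun w : W => tens v w).
Proof. by move=> c u w; rewrite /tens !linearP. Qed.

Lemma tliftE V W U (b : V -> W -> U) (v : V) (w : W) :
    (forall y, linear (b^~ y)) -> (forall x, linear (b x)) ->
  tlift b (tens v w) = b v w.
Proof.
move=> bl br.
pose BL y : {linear V -> U} := HB.pack (b^~ y)
  (GRing.isLinear.Build K V U *:%R (b^~ y) (bl y)).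
pose BR x : {linear W -> U} := HB.pack (b x)
  (GRing.isLinear.Build K W U *:%R (b x) (br x)).
transitivity (BL w v) => //; rewrite [in RHS](tbaseE v) linear_sum.
apply: eq_bigr => i _; rewrite linearZ /=.
transitivity (v2r v 0 i *: BR (tbase i) w) => //.
rewrite [in RHS](tbaseE w) linear_sum scaler_sumr.
apply: eq_bigr => j _; rewrite linearZ /= scalerA; congr (_ *: _).
by rewrite /tens mxE big_ord1 mxE.
Qed.

Lemma tens_baseE V W (i : 'I_(dim V)) (j : 'I_(dim W)) :
  tens (tbase i) (tbase j) = delta_mx i j.
Proof. by rewrite /tens !r2vK trmx_delta mul_delta_mx. Qed.

Lemma tlift_uniq V W U (f g : {linear tensor V W -> U}) :
  (forall v w, f (tens v w) = g (tens v w)) -> f =1 g.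
Proof.
move=> fg t.
have -> : t = \sum_i \sum_j
    (t : 'M[K]_(dim V, dim W)) i j *: tens (tbase i) (tbase j).
  rewrite {1}[t]matrix_sum_delta; apply: eq_bigr => i _.
  by apply: eq_bigr => j _; rewrite tens_baseE.
rewrite !linear_sum; apply: eq_bigr => i _.
by rewrite !linear_sum; apply: eq_bigr => j _; rewrite !linearZ /= fg.
Qed.

Definition tmap V W V' W' (f : V -> V') (g : W -> W') :
    tensor V W -> tensor V' W' :=
  tlift (fun v w => tens (f v) (g w)).

Definition tassoc V W U : tensor (tensor V W) U -> tensor V (tensor W U) :=
  tlift (fun t u => tlift (fun v w => tens v (tens w u)) t).

Lemma tassoc_tens V W U (v : V) (w : W) (u : U) :
  tassoc (tens (tens v w) u) = tens v (tens w u).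
Proof.
have H z : tlift (fun v w => tens v (tens w z)) (tens v w) =
    tens v (tens w z).
  apply: tliftE => [y k x x'|x k y y']; first by rewrite tens_linearl.
  by rewrite tens_linearl tens_linearr.
rewrite /tassoc tliftE ?H // => [y k x x'|x k y y']; first by rewrite linearP.
rewrite /tlift scaler_sumr -big_split; apply: eq_bigr => i _ /=.
rewrite scaler_sumr -big_split; apply: eq_bigr => j _ /=.
by rewrite !tens_linearr scalerDr !scalerA [_ * k]mulrC.
Qed.

(* f ⊗ ι and ι ⊗ f for a linear functional f, after K ⊗ W = W, V ⊗ K = V. *)
Definition slicel V W (f : V -> K) : tensor V W -> W :=
  tlift (fun v w => f v *: w).
Definition slicer V W (f : W -> K) : tensor V W -> V :=
  tlift (fun v w => f w *: v).

Lemma slicel_tens V W (f : {scalar V}) (v : V) (w : W) :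
  slicel f (tens v w) = f v *: w.
Proof.
rewrite /slicel tliftE // => [y k x x'|x k y y'].
  by rewrite linearP scalerDl scalerA.
by rewrite scalerDr !scalerA mulrC.
Qed.

Lemma slicer_tens V W (f : {scalar W}) (v : V) (w : W) :
  slicer f (tens v w) = f w *: v.
Proof.
rewrite /slicer tliftE // => [y k x x'|x k y y'].
  by rewrite scalerDr !scalerA mulrC.
by rewrite linearP scalerDl scalerA.
Qed.

Section Algebra.
Variable A : falgType K.
Implicit Types (Delta : {linear A -> tensor A A}) (phi eps : {scalar A}).

(* The product of the algebra A ⊗ A. *)
Definition tmul (s t : tensor A A) : tensor A A :=
  tlift (fun a b => tlift (fun c d => tens (a * c) (b * d)) t) s.

Lemma tmul_tens a b c d :
  tmul (tens a b) (tens c d) = tens (a * c) (b * d).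
Proof.
have H x y : tlift (fun c d => tens (x * c) (y * d)) (tens c d) =
    tens (x * c) (y * d).
  by apply: tliftE => [z k u v|z k u v];
    rewrite mulrDr -scalerAr ?tens_linearl ?tens_linearr.
rewrite /tmul tliftE ?H // => [y k u v|x k u v]; rewrite /tlift;
  rewrite scaler_sumr -big_split; apply: eq_bigr => i _ /=;
  rewrite scaler_sumr -big_split; apply: eq_bigr => j _ /=;
  by rewrite mulrDl -scalerAl ?tens_linearl ?tens_linearr scalerDr !scalerA
    [_ * k]mulrC.
Qed.

Definition coproduct Delta : Prop :=
  forall a, tassoc (tmap Delta id (Delta a)) = tmap id Delta (Delta a).

Definition counit Delta eps : Prop :=
  forall a, slicel eps (Delta a) = a /\ slicer eps (Delta a) = a.

Definition faithful phi : Prop :=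
  (forall a, (forall c, phi (a * c) = 0) -> a = 0) /\
  (forall c, (forall a, phi (a * c) = 0) -> c = 0).

Definition antipode Delta phi (S : {linear A -> A}) : Prop :=
  forall a c, S (slicer phi (tmul (Delta a) (tens 1 c))) =
              slicer phi (tmul (tens 1 a) (Delta c)).

Definition left_integral Delta phi : Prop := exists S, antipode Delta phi S.

Definition left_invariant Delta phi : Prop :=
  forall a, slicer phi (Delta a) = phi a *: 1.

End Algebra.
End Tensor.

(* Main.v *)
Require Import Defs.
From HB Require Import structures.
From mathcomp Require Import all_boot all_order all_algebra all_field.
From mathcomp Require Import complex reals.
Local Open Scope ring_scope.
Local Open Scope complex_scope.

(* Faithfulness in finite dimension makes every functional of the form
   [phi (d * _)] and of the form [phi (_ * c)].  Taking [phi (e * _) = eps]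
   in the defining property of S gives surjectivity, hence injectivity, of S.
   Write phi' = phi (d * _).  Left invariance of phi', the property of S and
   S(1) = 1 give d_(1) phi(d_(2) c) = phi(d c) 1 for all c; choosing c with
   phi (_ * c) = eps yields d = eps(d) 1, i.e. phi' = eps(d) phi. *)

Import GRing.Theory VectorInternalTheory.

(** Rank-nullity: when the image is all of [V], the kernel has dimension 0. *)
Lemma linear_surj_inj {K : fieldType} {V : vectType K} {f : {linear V -> V}} :
  (forall v, exists u, f u = v) -> injective f.
Proof.
move=> surj_f u v; rewrite -!(lfunE f); apply/lker0P.
have img : limg (linfun f) = fullv.
  apply/eqP; rewrite eqEsubv subvf; apply/subvP => w _.
  by have [x <-] := surj_f w; rewrite -(lfunE f) memv_img ?memvf.
have /eqP := limg_ker_dim (linfun f) fullv.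
by rewrite img capfv -[X in _ == X]add0n eqn_add2r dimv_eq0.
Qed.

(** Nondegeneracy makes [x] to [b x] an injection of [V] into its dual, and equal dimensions make it
    onto. *)
Lemma nondegenerate_repr {K : fieldType} {V : vectType K} {b : V -> V -> K^o}
    (b_linl : forall y, linear (b^~ y)) (b_linr : forall x, linear (b x))
    (b_nondeg : forall x, (forall y, b x y = 0) -> x = 0)
    (f : {scalar V}) :
  exists x, forall y, b x y = f y.
Proof.
have scalar_ext (g h : {scalar V}) :
    (forall i, g (tbase i) = h (tbase i)) -> g =1 h.
  move=> gh y; rewrite (tbaseE y) !linear_sum /=.
  by apply: eq_bigr => i _; rewrite !linearZ /= gh.
pose B x : {scalar V} := HB.pack (b x)
  (GRing.isLinear.Build K V K^o *:%R (b x) (b_linr x)).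
(* A functional is stored as the vector of [V] whose coordinates are its values on the basis, so the
   map into the dual becomes an endomorphism. *)
pose coords x : V := r2v (\row_i b x (tbase i)).
have coords_lin : linear coords.
  move=> k x y; rewrite /coords -linearP; congr r2v.
  by apply/rowP => i; rewrite !mxE b_linl.
pose C : {linear V -> V} := HB.pack coords
  (GRing.isLinear.Build K V V *:%R coords coords_lin).
have kerC : lker (linfun C) == 0%VS.
  apply/eqP/eqP; rewrite -subv0; apply/subvP => x.
  rewrite memv_ker memv0 lfunE /= => /eqP Cx0; apply/eqP/b_nondeg => y.
  rewrite -[b x y]/(B x y) (tbaseE y) linear_sum big1 // => i _.
  have := congr1 (fun v => v2r v 0 i) Cx0.
  by rewrite r2vK linear0 !mxE linearZ /= => ->; rewrite mulr0.
exists ((linfun C)^-1%VF (r2v (\row_i f (tbase i)))); set x := (X in b X).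
apply: (scalar_ext (B x)) => i /=.
have := lker0_lfunVK kerC (r2v (\row_i f (tbase i))).
rewrite lfunE => /(congr1 (fun v => v2r v 0 i)) /=.
by rewrite !r2vK !mxE.
Qed.

(** Gives linearity of [tmul] in its second factor, which enters only through the bilinear map being
    lifted. *)
Lemma tlift_param_linear {K : fieldType} {V W U X : vectType K}
    (b : X -> V -> W -> U) (t : tensor V W) :
  (forall v w, linear (fun x => b x v w)) -> linear (fun x => tlift (b x) t).
Proof.
move=> b_lin k x y; rewrite /tlift scaler_sumr -big_split.
apply: eq_bigr => i _; rewrite /= scaler_sumr -big_split; apply: eq_bigr => j _.
by rewrite b_lin scalerDr !scalerA [k * _]mulrC.
Qed.

Section Slices.
Variables (K : fieldType) (A : falgType K).
Implicit Types (phi f : {scalar A}) (t : tensor A A).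

Lemma tmul_linearr t : linear (tmul t).
Proof. by apply: tlift_param_linear => v w k x y; rewrite linearP. Qed.

(** Both sides are linear in [t], so pure tensors suffice; there the factor 1 leaves the first leg
    alone. *)
Lemma slicer_mull phi f a t : (forall x, phi (a * x) = f x) ->
  slicer phi (tmul (tens 1 a) t) = slicer f t.
Proof.
move=> phi_f; pose m : {linear tensor A A -> tensor A A} :=
  HB.pack (tmul (tens 1 a))
    (GRing.isLinear.Build K _ _ *:%R _ (tmul_linearr (tens 1 a))).
pose F : {linear tensor A A -> A} := tlift (fun v w => phi w *: v) \o m.
pose G : {linear tensor A A -> A} := tlift (fun v w => f w *: v).
rewrite -[LHS]/(F t) -[RHS]/(G t); apply: tlift_uniq => v w.
rewrite /= tmul_tens -/(slicer phi _) -/(slicer f _) !slicer_tens.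
by rewrite mul1r phi_f.
Qed.

Lemma slicer_mulr phi f c t : (forall x, phi (x * c) = f x) ->
  slicer phi (tmul t (tens 1 c)) = slicer f t.
Proof.
move=> phi_f.
(* Right multiplication by [tens 1 c], unfolded to a [tlift], which is linear by construction. *)
pose m : {linear tensor A A -> tensor A A} :=
  tlift (fun a b => tlift (fun x y => tens (a * x) (b * y)) (tens 1 c)).
pose F : {linear tensor A A -> A} := tlift (fun v w => phi w *: v) \o m.
pose G : {linear tensor A A -> A} := tlift (fun v w => f w *: v).
rewrite -[LHS]/(F t) -[RHS]/(G t); apply: tlift_uniq => v w.
rewrite /= -/(tmul _ _) tmul_tens -/(slicer phi _) -/(slicer f _) !slicer_tens.
by rewrite mulr1 phi_f.
Qed.

Lemma faithful_reprl phi f : faithful phi ->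
  exists d, forall x, phi (d * x) = f x.
Proof.
case=> phi_l _; apply: (nondegenerate_repr (b := fun d x => phi (d * x))) => //.
- by move=> y k u v; rewrite mulrDl -scalerAl linearP.
- by move=> x k u v; rewrite mulrDr -scalerAr linearP.
Qed.

(** Here [c] is the right factor, so the second half of faithfulness supplies nondegeneracy. *)
Lemma faithful_reprr phi f : faithful phi ->
  exists c, forall x, phi (x * c) = f x.
Proof.
case=> _ phi_r; apply: (nondegenerate_repr (b := fun c x => phi (x * c))) => //.
- by move=> y k u v; rewrite mulrDr -scalerAr linearP.
- by move=> x k u v; rewrite mulrDl -scalerAl linearP.
Qed.

Lemma antipode_inj (Delta : {linear A -> tensor A A}) (eps phi : {scalar A})
    (S : {linear A -> A}) :
  counit Delta eps -> faithful phi -> antipode Delta phi S -> injective S.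
Proof.
move=> eps_counit phi_faithful S_anti; apply: linear_surj_inj => c.
have [e eE] := faithful_reprl _ eps phi_faithful.
exists (slicer phi (tmul (Delta e) (tens 1 c))).
by rewrite S_anti (slicer_mull _ _ _ _ eE) (eps_counit c).2.
Qed.

End Slices.

Theorem proposition3p8 (R : realType) (A : falgType R[i])
    (Delta : {linear A -> tensor A A}) (hDelta : coproduct Delta)
    (hcounit : exists eps : {scalar A}, counit Delta eps)
    (phi : {scalar A}) (hfaithful : faithful phi)
    (hphi : left_integral Delta phi)
    (S : {linear A -> A}) (hS : antipode Delta phi S) (hS1 : S 1 = 1)
    (phi' : {scalar A}) (hphi' : left_invariant Delta phi') :
  exists c : R[i], forall a : A, phi' a = c * phi a.
Proof.
have [eps eps_counit] := hcounit.
have [d dE] := faithful_reprl _ _ _ phi' hfaithful.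
have [c cE] := faithful_reprr _ _ _ eps hfaithful.
(* The right side is [phi' c *: 1], the slice of [Delta c] by [phi']. The property of [S] turns it
   into [S] of a slice of [Delta d], which is [d] by the choice of [c]. *)
have : S d = S (phi (d * c) *: 1).
  rewrite linearZ /= hS1 dE -hphi' -(slicer_mull _ _ _ _ _ _ dE) -hS.
  by rewrite (slicer_mulr _ _ _ _ _ _ cE) (eps_counit d).2.
move/(antipode_inj _ _ _ _ _ _ eps_counit hfaithful hS) => d1.
by exists (phi (d * c)) => a; rewrite -dE {1}d1 -scalerAl mul1r linearZ.
Qed.
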